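(* Let $A$ be a finite set, $\Omega=A^{\mathbb{N}}$ with the product topology and Borel $\sigma$-algebra $\mathcal{F}$, and let $\mu\in\Delta(\Omega)$ be stationary (invariant under the left shift). Then the ergodic decomposition of $\mu$ is weakly learnable: if $\mu=\int_{\mathcal{E}}\nu\,\lambda(\mathrm{d}\nu)$ is the ergodic decomposition, then for $\lambda$-almost every ergodic $\nu$, the belief $\mu$ weakly merges to $\nu$, i.e. for $\nu$-almost every $\omega=(a_0,a_1,\dots)$, $$\frac{1}{N}\sum_{n=0}^{N-1}\bigl\|\mu(\cdot\mid a_0,\dots,a_{n-1})-\nu(\cdot\mid a_0,\dots,a_{n-1})\bigr\|\xrightarrow[N\to\infty]{}0 .$$
   Context: For $\mu\in\Delta(\Omega)$ and $(a_0,\dots,a_{n-1})\in A^n$ of positive $\mu$-probability, $\mu(\cdot\mid a_0,\dots,a_{n-1})\in\Delta(A)$ denotes the conditional distribution of the $n$-th coordinate $a_n$ given that the first $n$ coordinates are $a_0,\dots,a_{n-1}$. For $p,q\in\Delta(A)$, $\|p-q\|=\max_{a\in A}|p[a]-q[a]|$. A bounded real sequence $(x_n)$ strongly Cesaro converges to $x$ if $\frac1N\sum_{n=0}^{N-1}|x_n-x|\to0$. A belief $\tilde\mu$ weakly merges to $\mu$ if $\|\tilde\mu(\cdot\mid a_0,\dots,a_{n-1})-\mu(\cdot\mid a_0,\dots,a_{n-1})\|$ strongly Cesaro converges to $0$ for $\mu$-a.e. realization. A decomposition of $\mu$ is a standard probability space $(\Theta,\mathcal{B},\lambda)$ with measures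 $\mu_\theta\in\Delta(\Omega)$, $\theta\mapsto\mu_\theta(S)$ measurable, and $\mu(S)=\int\mu_\theta(S)\,\lambda(\mathrm d\theta)$ for all $S\in\mathcal{F}$; it is weakly learnable if $\mu$ weakly merges to $\mu_\theta$ for $\lambda$-a.e. $\theta$. The ergodic beliefs $\mathcal{E}$ are the extreme points of the convex set of stationary measures; every stationary $\mu$ has a unique representation $\mu=\int\nu\,\lambda(\mathrm d\nu)$ with $\lambda\in\Delta(\mathcal{E})$, called the ergodic decomposition. *)

(* Defs.v *)
From HB Require Import structures.
From mathcomp Require Import all_boot all_order all_algebra.
From mathcomp Require Import all_classical all_reals all_analysis.
Set Implicit Arguments. Unset Strict Implicit. Unset Printing Implicit Defensive.
Import Order.TTheory GRing.Theory Num.Theory.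
Import numFieldNormedType.Exports.
Local Open Scope classical_set_scope.
Local Open Scope ring_scope.

(* Sequences over the finite alphabet A: the raw carrier nat -> A, pointed by
   the constant sequence a0 (needed only for the pointedType structure). *)
Definition seqA (A : finType) (a0 : A) : Type := nat -> A.
HB.instance Definition _ (A : finType) (a0 : A) := Choice.on (@seqA A a0).
HB.instance Definition _ (A : finType) (a0 : A) :=
  isPointed.Build (@seqA A a0) (fun _ => a0).

Definition cyl (A : finType) (a0 : A) (s : seq A) : set (seqA a0) :=
  [set w | forall i, (i < size s)%N -> w i = nth a0 s i].

(* Omega = A^N with the sigma-algebra generated by cylinder sets
   (= Borel sigma-algebra of the product topology, A discrete and finite). *)
Definition Omega (A : finType) (a0 : A) :=
  g_sigma_algebraType (range (@cyl A a0)).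

Definition shift (A : finType) (a0 : A) (w : Omega a0) : Omega a0 :=
  fun n => w n.+1.

Definition prefix (A : finType) (a0 : A) (w : Omega a0) (n : nat) : seq A :=
  mkseq w n.

Section defs.
Context (R : realType) (A : finType) (a0 : A).
Local Notation Om := (Omega a0).

Definition stationary (mu : probability Om R) : Prop :=
  forall S : set Om, measurable S -> mu (@shift A a0 @^-1` S) = mu S.

(* ergodic = extreme point of the convex set of stationary probability
   measures (measures identified when they agree on measurable sets) *)
Definition ergodic (nu : probability Om R) : Prop :=
  stationary nu /\
  forall (nu1 nu2 : probability Om R) (t : R), 0 < t < 1 ->
    stationary nu1 -> stationary nu2 ->
    (forall S : set Om, measurable S ->
        nu S = (t%:E * nu1 S + (1 - t)%:E * nu2 S)%E) ->
    forall S : set Om, measurable S -> nu1 S = nu2 S.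

(* mu(a | s): conditional probability that the next coordinate is a, given
   that the first size s coordinates are s (only meaningful when mu(cyl s)>0;
   equals 0 otherwise by the convention x / 0 = 0). *)
Definition cond (mu : probability Om R) (s : seq A) (a : A) : R :=
  fine (mu (@cyl A a0 (rcons s a))) / fine (mu (@cyl A a0 s)).

Definition cond_dist (mu nu : probability Om R) (s : seq A) : R :=
  \big[Num.max/0]_(a : A) `|cond mu s a - cond nu s a|.

Definition strong_cesaro (x : nat -> R) (l : R) : Prop :=
  (fun N : nat => N%:R^-1 * \sum_(n < N) `|x n - l|) @ \oo --> 0.

Definition weakly_merges (mut mu : probability Om R) : Prop :=
  {ae mu, forall w : Om,
      strong_cesaro (fun n => cond_dist mut mu (prefix w n)) 0}.

(* lam (a probability on the space of probability measures on Omega, with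
   the sigma-algebra generated by the evaluations nu |-> nu S) is the
   ergodic decomposition of mu *)
Definition ergodic_decomposition (mu : probability Om R)
    (lam : probability (pprobability Om R) R) : Prop :=
  lam.-negligible (~` [set nu : pprobability Om R | ergodic nu]) /\
  forall S : set Om, measurable S ->
    mu S = (\int[lam]_(nu in [set: pprobability Om R]) nu S)%E.

End defs.

(* Main.v *)
Require Import Defs.
From HB Require Import structures.
From mathcomp Require Import all_boot all_order all_algebra.
From mathcomp Require Import all_classical all_reals all_analysis.
From mathcomp Require Import measurable_realfun ring lra zify.
Set Implicit Arguments. Unset Strict Implicit. Unset Printing Implicit Defensive.
Import Order.TTheory GRing.Theory Num.Theory.
Import numFieldNormedType.Exports.
Local Open Scope classical_set_scope.
Local Open Scope ring_scope.

(** Fix a letter [a] and let g_nu(s) = nu(a | s).  Under the joint law of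
    (nu, w), the values of g_nu on longer and longer pasts of the current letter
    form an L2-bounded martingale, and so do those of g_mu.  A posterior mean
    given w_0 .. w_(j-1) is a bounded martingale in j, so its increments tend to
    0; with the approximation of g_nu by its values on pasts of a bounded length
    this yields E (g_nu - g_mu)^2 -> 0 along words of growing length.
    Kolmogorov's inequality then makes it unlikely that |g_nu - g_mu| ever gets
    large on a past longer than k.  Since this event grows with the past,
    Hopf's maximal inequality on finite windows turns the small probability into
    a small frequency, uniformly in N, without a two-sided extension. *)

(** * Words and martingales along left-extensions *)

Section words.
Variable A : finType.
Implicit Types s u : seq A.

Fixpoint words (n : nat) : seq (seq A) :=
  if n is m.+1 then [seq a :: s | a <- enum A, s <- words m] else [:: [::]].

Lemma mem_words n s : (s \in words n) = (size s == n).
Proof.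
elim: n s => [|n IH] [|a s] //=; first by apply/allpairsP => -[[a s] []].
rewrite eqSS -IH; apply/allpairsP/idP => [[[b t] /= [_ tn [_ ->]]]//|sn].
by exists (a, s); rewrite mem_enum.
Qed.

Lemma uniq_words n : uniq (words n).
Proof.
elim: n => //= n IH; apply: allpairs_uniq => //; first exact: enum_uniq.
by move=> [a s] [b t] _ _ [-> ->].
Qed.

Variable V : nmodType.
Implicit Types F : seq A -> V.

Lemma big_words0 F : \sum_(s <- words 0) F s = F [::].
Proof. by rewrite big_seq1. Qed.

Lemma big_words_cons n F :
  \sum_(s <- words n.+1) F s = \sum_a \sum_(s <- words n) F (a :: s).
Proof. by rewrite /= big_allpairs_dep big_enum. Qed.

Lemma big_words_cat m n F :
  \sum_(s <- words (m + n)) F s =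
  \sum_(s <- words m) \sum_(u <- words n) F (s ++ u).
Proof.
elim: m F => [|m IH] F; first by rewrite big_words0.
by rewrite addSn !big_words_cons; apply: eq_bigr => a _; rewrite IH.
Qed.

Lemma big_words_rcons n F :
  \sum_(s <- words n.+1) F s = \sum_(s <- words n) \sum_a F (rcons s a).
Proof.
rewrite -addn1 big_words_cat; apply: eq_bigr => s _.
rewrite big_words_cons; apply: eq_bigr => a _.
by rewrite big_words0 cats1.
Qed.

(** Reversal permutes the words of length [n]; this turns martingales along right-extensions into
    martingales along left-extensions. *)
Lemma big_words_rev n F :
  \sum_(s <- words n) F (rev s) = \sum_(s <- words n) F s.
Proof.
elim: n F => [|n IH] F; first by rewrite !big_words0.
rewrite big_words_rcons big_words_cons exchange_big/=; apply: eq_bigr => a _.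
by rewrite -(IH (fun s => F (a :: s))); apply: eq_bigr => s _; rewrite rev_rcons.
Qed.

End words.

Section density.
Variables (R : realFieldType) (A : finType) (p f : seq A -> R).
Hypothesis f_ge0 : forall s, 0 <= f s.
Hypothesis f_le : forall s, f s <= p s.
Hypothesis p_cons : forall s, \sum_a p (a :: s) = p s.
Hypothesis f_cons : forall s, \sum_a f (a :: s) = f s.
Implicit Types s u : seq A.

(** Under [p], this is a martingale as letters are prepended to [s]. Words with [p s = 0] get the
    value 0. *)
Definition density s := f s / p s.
Local Notation r := density.

(** Since [p s * r s = f s], this is the second moment of the martingale at length [n]. *)
Definition energy n := \sum_(s <- words A n) f s * r s.

Let p_ge0 s : 0 <= p s. Proof. exact: le_trans (f_le s). Qed.

(** If [p s = 0], the bounds on [f] force [f s = 0], so the default value of the quotient does no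
    harm. *)
Lemma mul_density s : p s * r s = f s.
Proof.
rewrite /density; have [p0|p0] := eqVneq (p s) 0; last by rewrite mulrC divfK.
rewrite p0 mul0r; apply/le_anti.
by rewrite f_ge0 -p0 f_le.
Qed.

Lemma density_ge0 s : 0 <= r s. Proof. by rewrite divr_ge0. Qed.

Lemma density_le1 s : r s <= 1.
Proof.
have [p0|p0] := eqVneq (p s) 0; first by rewrite /density p0 invr0 mulr0.
by rewrite ler_pdivrMr ?mul1r// lt_def p0 p_ge0.
Qed.

Lemma sum_words_cat (q : seq A -> R) m u : (forall s, \sum_a q (a :: s) = q s) ->
  \sum_(s <- words A m) q (s ++ u) = q u.
Proof.
move=> q_cons; elim: m => [|m IH]; first by rewrite big_words0.
by rewrite big_words_cons exchange_big/= -[RHS]IH; apply: eq_bigr => s _.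
Qed.

Lemma sum_words (q : seq A -> R) m : (forall s, \sum_a q (a :: s) = q s) ->
  \sum_(s <- words A m) q s = q [::].
Proof.
move=> q_cons; rewrite -(sum_words_cat m [::] q_cons).
by apply: eq_bigr => s _; rewrite cats0.
Qed.

(** Orthogonality of martingale increments: once the square is expanded, the terms that involve
    [r u] sum to [- f u * r u]. *)
Lemma energy_increment k m :
  \sum_(u <- words A k) \sum_(s <- words A m) p (s ++ u) * (r (s ++ u) - r u) ^+ 2
  = energy (m + k) - energy k.
Proof.
rewrite /energy big_words_cat [X in _ = X - _]exchange_big -sumrB.
apply: eq_bigr => u _ /=.
transitivity (\sum_(s <- words A m) (f (s ++ u) * r (s ++ u)
   + (r u ^+ 2 * p (s ++ u) - 2 * r u * f (s ++ u)))).
  by apply: eq_bigr => s _; rewrite -mul_density; ring.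
rewrite big_split/= sumrB -!mulr_sumr !sum_words_cat//.
by rewrite -(mul_density u); ring.
Qed.

Lemma energy_le n : energy n <= p [::].
Proof.
rewrite -(sum_words n p_cons); apply: ler_sum => s _.
rewrite (le_trans _ (f_le s))// -[leRHS]mulr1.
by rewrite ler_wpM2l// density_le1.
Qed.

Lemma energy_nondecreasing m k : energy k <= energy (m + k).
Proof.
rewrite -subr_ge0 -energy_increment; apply: sumr_ge0 => u _.
by apply: sumr_ge0 => s _; rewrite mulr_ge0 ?sqr_ge0.
Qed.

(* Used in place of the Cauchy-Schwarz inequality. *)
Lemma norm_le_sqr (e d : R) : 0 < e -> `|d| <= e + d ^+ 2 / e.
Proof.
move=> e0; have [de|/ltW ed] := leP `|d| e.
  by rewrite (le_trans de)// lerDl divr_ge0 ?sqr_ge0 ?ltW.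
apply: (@le_trans _ _ (d ^+ 2 / e)); last by rewrite lerDr ltW.
by rewrite ler_pdivlMr// -real_normK ?num_real// expr2 ler_wpM2l.
Qed.

Lemma density_increment_L1 (e : R) k m : 0 < e ->
  \sum_(u <- words A k) \sum_(s <- words A m) p (s ++ u) * `|r (s ++ u) - r u|
  <= e * p [::] + (energy (m + k) - energy k) / e.
Proof.
move=> e0; rewrite -energy_increment -(sum_words k p_cons) mulr_sumr mulr_suml.
rewrite -big_split/=; apply: ler_sum => u _.
rewrite -(sum_words_cat m u p_cons) mulr_sumr mulr_suml -big_split/=.
apply: ler_sum => s _; rewrite [e * _]mulrC -mulrA -mulrDr.
by rewrite ler_wpM2l// norm_le_sqr.
Qed.

(** The recursion visits every suffix of [s], that is, every time of the martingale started at [u];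
    hence the event is inherited by left-extensions. *)
Fixpoint deviates (e : R) u s :=
  (e < `|r (s ++ u) - r u|) ||
  (if s is _ :: s' then deviates e u s' else false).

(* Kolmogorov's maximal inequality for the martingale of densities along
   left-extensions of a word. *)
Lemma maximal_density (e : R) k m : 0 < e ->
  e ^+ 2 * (\sum_(u <- words A k) \sum_(s <- words A m)
     p (s ++ u) * (deviates e u s)%:R)
  <= energy (m + k) - energy k.
Proof.
move=> e0; rewrite -energy_increment mulr_sumr; apply: ler_sum => u _.
pose d s := r (s ++ u) - r u.
(* It is enough that, on the event, [d ^+ 2] averages to at least [e ^+ 2]; off the event, [d ^+ 2]
   is nonnegative anyway. *)
suff: 0 <= \sum_(s <- words A m)
    p (s ++ u) * (deviates e u s)%:R * (d s ^+ 2 - e ^+ 2).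
  move=> H; rewrite -subr_ge0; apply: le_trans H _.
  rewrite mulr_sumr -sumrB; apply: ler_sum => s _; rewrite -/(d s).
  have := p_ge0 (s ++ u); have := sqr_ge0 (d s).
  case: deviates => /=; nra.
elim: m => [|m IH].
  by rewrite big_words0/= subrr normr0 orbF lt_gtF//= mulr0 mul0r.
rewrite big_words_cons exchange_big/=.
apply: le_trans IH _; apply: ler_sum => s _.
(* Before the first deviation, a new letter either contributes nothing or brings a term with
   [d ^+ 2] at least [e ^+ 2]. *)
have [ds|Nds] := boolP (deviates e u s); last first.
  rewrite mulr0 mul0r; apply: sumr_ge0 => a _.
  rewrite orbF; have [ed|_] := ltP; last by rewrite mulr0 mul0r.
  rewrite mulr1 mulr_ge0// subr_ge0 -[leRHS]real_normK ?num_real//.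
  by rewrite lerXn2r ?nnegrE ?normr_ge0 ?(ltW e0)// ltW.
under eq_bigr do rewrite orbT mulr1.
rewrite mulr1 -subr_ge0.
have ps : \sum_a p (a :: s ++ u) = p (s ++ u) by rewrite p_cons.
have fs : \sum_a f (a :: s ++ u) = f (s ++ u) by rewrite f_cons.
(* After a deviation, the old term is a sum over letters of the tangent line of the square at
   [r (s ++ u)], whose slope terms cancel by the martingale property. Each new term exceeds its
   tangent by [P * (x - y) ^+ 2]. *)
have -> : p (s ++ u) * (d s ^+ 2 - e ^+ 2) =
    \sum_a ((d s ^+ 2 - e ^+ 2) * p (a :: s ++ u)
   + 2 * d s * (f (a :: s ++ u) - r (s ++ u) * p (a :: s ++ u))).
  by rewrite big_split/= -!mulr_sumr sumrB -mulr_sumr ps fs -mul_density; ring.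
rewrite -sumrB; apply: sumr_ge0 => a _.
rewrite -[f _]mul_density /d /=.
have := p_ge0 (a :: s ++ u); set P := p _ => P0.
set x := r (a :: _); set y := r (s ++ u); set z := r u.
have -> : P * ((x - z) ^+ 2 - e ^+ 2) -
 (((y - z) ^+ 2 - e ^+ 2) * P + 2 * (y - z) * (P * x - y * P)) = P * (x - y) ^+ 2.
  by ring.
by rewrite mulr_ge0 ?sqr_ge0.
Qed.

End density.

(** * The maximal ergodic inequality *)

Section hopf.
Variables (R : realFieldType) (y : nat -> R) (e : R).
Hypotheses (y_ge0 : forall n, 0 <= y n).

(* The largest partial sum of [y - e] over intervals starting at [i] of
   length at most [d]. *)
Fixpoint max_excess (i d : nat) : R :=
  if d is d'.+1 then Num.max 0 (y i - e + max_excess i.+1 d') else 0.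

Lemma max_excess_ge i d N : (N <= d)%N ->
  \sum_(n < N) y (i + n)%N - e * N%:R <= max_excess i d.
Proof.
elim: d i N => [|d IH] i [|N]//= Nd;
  rewrite ?big_ord0 ?mulr0 ?subrr ?le_max ?lexx//.
apply/orP; right; rewrite big_ord_recl addn0 -natr1 mulrDr mulr1.
under eq_bigr do rewrite lift0 addnS -addSn.
by have := IH i.+1 N Nd; lra.
Qed.

(** With [G j] the excess from [i + j] on the remaining [d - j] indices, [G j > 0] gives
    [e = y (i + j) - G j + G j.+1], and [G j = 0] makes the right side nonnegative. Summing over [j]
    telescopes. *)
Lemma count_max_excess i d :
  e * (\sum_(j < d) (0 < max_excess (i + j) (d - j))%R%:R)
  <= \sum_(j < d) y (i + j)%N - max_excess i d.
Proof.
elim: d i => [|d IH] i; first by rewrite !big_ord0 mulr0 subrr.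
rewrite !big_ord_recl addn0 subn0 mulrDr.
under eq_bigr do rewrite lift0 subSS addnS -addSn.
under [in leRHS]eq_bigr do rewrite lift0 addnS -addSn.
have := IH i.+1; set S := \sum_(_ < _) _; set T := \sum_(_ < _) _.
rewrite [max_excess i d.+1]/=.
have := y_ge0 i; have G0 : 0 <= max_excess i.+1 d.
  by case: (d) => //= ?; rewrite le_max lexx.
set G := max_excess _ _ in G0 *.
by case: (ltP 0 (y i - e + G)) => /= h; rewrite ?ltxx ?h ?mulr0 ?mulr1; lra.
Qed.

End hopf.

Section maximal_ergodic.
Variables (R : realFieldType) (A : finType) (p : seq A -> R).
Hypothesis p_ge0 : forall s, 0 <= p s.
Hypothesis p_cons : forall s, \sum_a p (a :: s) = p s.
Hypothesis p_rcons : forall s, \sum_a p (rcons s a) = p s.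
Variables (D : pred (seq A)) (e : R).
Hypothesis e_ge0 : 0 <= e.
Hypothesis D_cons : forall a s, D s -> D (a :: s).

Definition exceeds (M : nat) (t : seq A) :=
  has (fun N => e * N%:R < \sum_(n < N) (D (take n t))%:R)%R (iota 0 M.+1).

Lemma sum_words_catr m s : \sum_(u <- words A m) p (s ++ u) = p s.
Proof.
elim: m => [|m IH]; first by rewrite big_words0 cats0.
rewrite big_words_rcons -[RHS]IH; apply: eq_bigr => u _.
by rewrite -[RHS]p_rcons; apply: eq_bigr => a _; rewrite rcons_cat.
Qed.

Lemma sum_words_take m n (F : seq A -> R) :
  \sum_(s <- words A (m + n)) p s * F (take m s) =
  \sum_(s <- words A m) p s * F s.
Proof.
rewrite big_words_cat big_seq [RHS]big_seq; apply: eq_bigr => s.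
rewrite mem_words => /eqP sm.
under eq_bigr do rewrite (take_size_cat _ sm).
by rewrite -mulr_suml sum_words_catr.
Qed.

(** Leading letters are summed out by [p_cons], the finite form of stationarity. *)
Lemma sum_words_drop m n (F : seq A -> R) :
  \sum_(s <- words A (m + n)) p s * F (drop m s) =
  \sum_(s <- words A n) p s * F s.
Proof.
rewrite big_words_cat exchange_big/=; apply: eq_bigr => u _.
rewrite -[in RHS](sum_words_cat m u p_cons) mulr_suml big_seq [RHS]big_seq.
by apply: eq_bigr => s; rewrite mem_words => /eqP <-; rewrite drop_size_cat.
Qed.

(** A prefix of [drop i z] is a suffix of a prefix of [z], so [D_cons] carries occurrences of [D]
    from the shifted word to [z]. A window that exceeds at [i] thus makes [max_excess] positive
    there; for [i < L] the window fits in length [L + M]. *)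
Lemma exceeds_count M L z :
  e * (\sum_(i < L) (exceeds M (take M (drop i z)))%:R)
  <= \sum_(n < L + M) (D (take n z))%:R :> R.
Proof.
set y := fun n => (D (take n z))%:R : R.
have y0 n : 0 <= y n by rewrite /y ler0n.
apply: le_trans (le_trans (count_max_excess e y0 0 (L + M)) _); last first.
  by rewrite gerBl; case: (L + M)%N => //= ?; rewrite le_max lexx.
rewrite ler_wpM2l// big_split_ord/= -[leLHS]addr0 lerD ?sumr_ge0//.
apply: ler_sum => i _; rewrite add0n ler_nat.
have [/hasP[N]|//] := boolP (exceeds _ _).
rewrite mem_iota ltnS/= => NM lt_eN; rewrite lt0b.
have NL : (N <= L + M - i)%N.
  by rewrite (leq_trans NM)// leq_subRL ?leq_add2r ltnW// ltn_addr.
apply: lt_le_trans (max_excess_ge y e i NL); rewrite subr_gt0.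
apply: lt_le_trans lt_eN _; apply: ler_sum => n _; rewrite ler_nat.
rewrite take_takel ?(leq_trans (ltnW (ltn_ord n)))// /y takeD.
elim: (take i z) => [|a s IH]; first by case: (D _).
by rewrite (leq_trans IH)//; case E: (D (s ++ _)) => //; rewrite (D_cons a E).
Qed.

(* Hopf's maximal inequality: averaging over the [L] shifts of a window of
   length [L + M] and letting [L] grow replaces the two-sided extension. *)
Lemma maximal_ergodic M L :
  e * L%:R * (\sum_(t <- words A M) p t * (exceeds M t)%:R)
  <= \sum_(n < L + M) \sum_(s <- words A n) p s * (D s)%:R.
Proof.
apply: (@le_trans _ _ (\sum_(z <- words A (L + M))
    p z * (e * (\sum_(i < L) (exceeds M (take M (drop i z)))%:R)))); last first.
  apply: (@le_trans _ _ (\sum_(z <- words A (L + M))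
      p z * \sum_(n < L + M) (D (take n z))%:R)).
    by apply: ler_sum => z _; rewrite ler_wpM2l// exceeds_count.
  under eq_bigr do rewrite mulr_sumr.
  rewrite exchange_big/=; apply: ler_sum => -[n /= nLM] _.
  rewrite -(subnKC (ltnW nLM)).
  by rewrite (sum_words_take _ _ (fun s => (D s)%:R)).
under [leRHS]eq_bigr do rewrite mulrCA mulr_sumr.
rewrite -mulr_sumr [in leRHS]exchange_big/= -mulrA.
have E (i : 'I_L) : \sum_(z <- words A (L + M))
    p z * (exceeds M (take M (drop i z)))%:R =
    \sum_(t <- words A M) p t * (exceeds M t)%:R :> R.
  (* The [i] letters before the window and the [L - i] letters after it are summed out
     separately. *)
  have -> : (L + M = i + (M + (L - i)))%N by have := ltn_ord i; lia.
  rewrite (sum_words_drop _ _ (fun u => (exceeds M (take M u))%:R)).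
  by rewrite (sum_words_take _ _ (fun u => (exceeds M u)%:R)).
by rewrite (eq_bigr _ (fun i _ => E i)) sumr_const card_ord -[in leRHS]mulr_natl.
Qed.

End maximal_ergodic.

(** * Finite-dimensional laws of a measure on sequences *)

Lemma measure_disjoint_sum d (T : measurableType d) (R : realType)
    (mu : {measure set T -> \bar R}) (I : choiceType) (l : seq I) (F : I -> set T) :
  uniq l -> (forall i, measurable (F i)) ->
  (forall i j, i != j -> F i `&` F j = set0) ->
  mu (\big[setU/set0]_(i <- l) F i) = (\sum_(i <- l) mu (F i))%E.
Proof.
move=> + mF dF; elim: l => [|i l IH]/=; first by rewrite !big_nil measure0.
move=> /andP[il ul]; rewrite !big_cons.
rewrite measureU//; [by congr (_ + _)%E; exact: IH| |].
  by apply: bigsetU_measurable => j _; exact: mF.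
rewrite -bigcup_seq setI_bigcupr; apply: bigcup0 => j /= jl.
by apply: dF; apply: contraNneq il => ->.
Qed.

Section law.
Variables (R : realType) (A : finType) (a0 : A).
Local Notation Om := (Omega a0).
Local Notation cyl := (@cyl A a0).
Local Notation prefix := (@Defs.prefix A a0).
Implicit Types (nu : probability Om R) (s : seq A).

Lemma take_prefix (w : Om) n M : (n <= M)%N -> take n (prefix w M) = prefix w n.
Proof.
by move=> nM; rewrite /Defs.prefix /mkseq -map_take take_iota (minn_idPl nM).
Qed.

Lemma cylE s : cyl s = [set w : Om | prefix w (size s) = s].
Proof.
apply/seteqP; split=> w /= ws.
  apply: (@eq_from_nth _ a0); first by rewrite size_mkseq.
  by move=> i; rewrite size_mkseq => si; rewrite nth_mkseq// ws.
by move=> i si; rewrite -[in RHS]ws nth_mkseq.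
Qed.

Lemma measurable_cyl s : measurable (cyl s : set Om).
Proof. by apply: sub_sigma_algebra; exists s. Qed.

Lemma cyl_disjoint s t : size s = size t -> s != t ->
  (cyl s : set Om) `&` cyl t = set0.
Proof.
move=> st; apply: contra_neqP => /eqP/set0P[w []].
by rewrite !cylE /= st => -> ->.
Qed.

Definition law nu s : R := fine (nu (cyl s)).

Lemma lawE nu s : nu (cyl s) = (law nu s)%:E.
Proof. by rewrite fineK// fin_num_measure//; exact: measurable_cyl. Qed.

Lemma law_ge0 nu s : 0 <= law nu s. Proof. exact: fine_ge0. Qed.

Lemma law_nil nu : law nu [::] = 1.
Proof.
rewrite /law (_ : cyl [::] = setT) ?probability_setT//.
by apply/seteqP; split.
Qed.

Lemma prefix_set_words (P : pred (seq A)) n : [set w : Om | P (prefix w n)] =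
  \big[setU/set0]_(s <- words A n) if P s then cyl s else set0.
Proof.
rewrite -bigcup_seq; apply/seteqP; split=> [w /= Pw|w [s /=]].
  exists (prefix w n); first by rewrite /= mem_words size_mkseq.
  by rewrite Pw cylE /= size_mkseq.
by rewrite mem_words cylE => /eqP <-; case: ifPn => //= Ps ->.
Qed.

Lemma measurable_prefix (P : pred (seq A)) n :
  measurable [set w : Om | P (prefix w n)].
Proof.
rewrite prefix_set_words; apply: bigsetU_measurable => s _.
by case: ifP => // _; exact: measurable_cyl.
Qed.

Lemma measure_prefix nu (P : pred (seq A)) n :
  nu [set w : Om | P (prefix w n)] =
  (\sum_(s <- words A n) law nu s * (P s)%:R)%:E.
Proof.
rewrite prefix_set_words.
(* Cylinders of words of different lengths can be nested; emptying those of the wrong length makes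
   the whole family disjoint. *)
pose F s : set Om := if P s && (s \in words A n) then cyl s else set0.
rewrite big_seq (eq_bigr F) => [|s sn]; last by rewrite /F sn andbT.
rewrite -big_seq measure_disjoint_sum ?uniq_words//.
- rewrite big_seq [in RHS]big_seq -sumEFin; apply: eq_bigr => s sn.
  rewrite /F sn andbT; case: (P s); rewrite ?mulr1 ?mulr0 ?measure0//.
  exact: lawE.
- by move=> s; rewrite /F; case: ifP => // _; exact: measurable_cyl.
- move=> s t; rewrite /F; case: ifP => [|_]; last by rewrite set0I.
  case: ifP => [|_]; last by rewrite setI0.
  rewrite !mem_words => /andP[_ /eqP tn] /andP[_ /eqP sn] st.
  by rewrite cyl_disjoint// tn.
Qed.

Lemma law_rcons nu s : \sum_a law nu (rcons s a) = law nu s.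
Proof.
suff : (\sum_a law nu (rcons s a))%:E = (law nu s)%:E by case.
rewrite -lawE -sumEFin; under eq_bigr do rewrite -lawE.
rewrite -big_enum -measure_disjoint_sum ?enum_uniq//.
- congr (nu _); rewrite -bigcup_seq; apply/seteqP; split=> [w [a /= _]|w].
    rewrite !cylE/= size_rcons /Defs.prefix mkseqS.
    by move/rcons_inj => [].
  rewrite !cylE /= => ws; exists (w (size s)); first by rewrite /= mem_enum.
  rewrite cylE/= size_rcons /Defs.prefix mkseqS.
  by congr (rcons _ _).
- by move=> a; exact: measurable_cyl.
- by move=> a b ab; rewrite cyl_disjoint ?size_rcons// eqseq_rcons eqxx.
Qed.

(** The preimage of [cyl s] under the shift is the disjoint union of the cylinders of [a :: s].
    Stationarity enters the argument through this identity. *)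
Lemma law_cons nu s : stationary nu -> \sum_a law nu (a :: s) = law nu s.
Proof.
move=> st; suff : (\sum_a law nu (a :: s))%:E = (law nu s)%:E by case.
rewrite -lawE -st; last exact: measurable_cyl.
rewrite -sumEFin; under eq_bigr do rewrite -lawE.
rewrite -big_enum -measure_disjoint_sum ?enum_uniq//.
- congr (nu _); rewrite -bigcup_seq; apply/seteqP; split=> [w [a /= _] aw|w /= ws].
    by move=> i si; exact: (aw i.+1).
  exists (w 0%N); first by rewrite /= mem_enum.
  by move=> [|i] //= si; exact: ws.
- by move=> a; exact: measurable_cyl.
- by move=> a b ab; rewrite cyl_disjoint// eqseq_cons (negPf ab).
Qed.

Lemma law_rcons_le nu s a : law nu (rcons s a) <= law nu s.
Proof.
rewrite -(law_rcons nu s) (bigD1 a)//= lerDl.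
by apply: sumr_ge0 => b _; exact: law_ge0.
Qed.

(** The event is the increasing union over [M] of events read off the first [M] letters; for each of
    them, [maximal_ergodic] is used with [L] large compared with [M]. *)
Lemma exceeds_measure nu (D : pred (seq A)) (e : R) (c : \bar R) :
  stationary nu -> 0 < e -> (forall a s, D s -> D (a :: s)) ->
  (forall n, nu [set w : Om | D (prefix w n)] <= c)%E ->
  (e%:E * nu [set w : Om | exists N,
     (e * N%:R < \sum_(n < N) (D (prefix w n))%:R)%R]
   <= c)%E.
Proof.
move=> st e0 Dc Dle.
pose E M : set Om := [set w | exceeds D e M (prefix w M)].
have -> : [set w : Om | exists N, e * N%:R < \sum_(n < N) (D (prefix w n))%:R] =
    \bigcup_M E M.
  apply/seteqP; split=> [w /= [N eN]|w [M _ /hasP[N]]].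
    exists N => //; apply/hasP; exists N; first by rewrite mem_iota/= add0n ltnS.
    apply: lt_le_trans eN _; apply: ler_sum => n _.
    by rewrite take_prefix// ltnW.
  rewrite mem_iota add0n ltnS/= => NM eN; exists N.
  apply: lt_le_trans eN _; apply: ler_sum => n _.
  by rewrite take_prefix// (leq_trans (ltnW (ltn_ord n))).
have mE M : measurable (E M) by exact: measurable_prefix.
have ndE : nondecreasing_seq E.
  move=> M M' MM'; apply/subsetPset => w /hasP[N].
  rewrite mem_iota add0n ltnS/= => NM eN; apply/hasP; exists N.
    by rewrite mem_iota add0n ltnS/= (leq_trans NM).
  apply: lt_le_trans eN _; apply: ler_sum => n _.
  have nM : (n <= M)%N by rewrite (leq_trans (ltnW (ltn_ord n))).
  by rewrite !take_prefix// (leq_trans nM).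
have : (fun M => e%:E * nu (E M))%E @ \oo --> (e%:E * nu (\bigcup_M E M))%E.
  apply: cvgeZl => //; apply: nondecreasing_cvg_mu => //.
  exact: bigcupT_measurable.
move=> /cvg_lim <-//; apply: lime_le.
  apply: ereal_nondecreasing_is_cvgn => M M' MM'.
  rewrite lee_pmul2l// le_measure ?inE//.
  exact/subsetPset/ndE.
apply: nearW => M; rewrite /E measure_prefix -EFinM.
have c0 : (0 <= c)%E by apply: le_trans (Dle 0%N).
case: c c0 Dle => [c||//] c0 Dle; last by rewrite leey.
rewrite lee_fin; set P := \sum_(_ <- _) _.
have H L : e * L%:R * P <= (L + M)%:R * c.
  have := @maximal_ergodic R A (law nu) (law_ge0 nu) (fun s => law_cons s st)
    (law_rcons nu) D e (ltW e0) Dc M L.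
  move=> /le_trans; apply.
  apply: (@le_trans _ _ (\sum_(n < L + M) c)); last first.
    by rewrite sumr_const card_ord mulr_natl.
  by apply: ler_sum => n _; rewrite -lee_fin -measure_prefix.
rewrite leNgt; apply/negP => cP.
(* This bound on [L] is [(L + M) * c < e * L * P] solved for [L]. *)
have [L LM] : exists L : nat, M%:R * c / (e * P - c) < L%:R.
  by exists (Num.truncn (M%:R * c / (e * P - c))).+1; exact: truncnS_gt.
have := H L; rewrite leNgt => /negP; apply.
move: LM; rewrite ltr_pdivrMr ?subr_gt0// natrD; lra.
Qed.

End law.

(** * Bounded measurable functions of a random measure *)

Section mean.
Context d (T : measurableType d) (R : realType) (P : probability T R).
Variables (D : set T).
Hypotheses (mD : measurable D) (PD : P D = 1%E).
Implicit Types f g : T -> R.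

Definition bounded_measurable f :=
  measurable_fun setT f /\ exists M, forall x, `|f x| <= M.
Local Notation bm := bounded_measurable.

Lemma bm_cst (c : R) : bm (fun=> c).
Proof. by split; [exact: measurable_cst|exists `|c|]. Qed.

Lemma bmD f g : bm f -> bm g -> bm (fun x => f x + g x).
Proof.
move=> [mf [M fM]] [mg [N gN]]; split; first exact: measurable_funD.
by exists (M + N) => x; rewrite (le_trans (ler_normD _ _))// lerD.
Qed.

Lemma bmM f g : bm f -> bm g -> bm (fun x => f x * g x).
Proof.
move=> [mf [M fM]] [mg [N gN]]; split; first exact: measurable_funM.
by exists (M * N) => x; rewrite normrM ler_pM.
Qed.

Lemma bmB f g : bm f -> bm g -> bm (fun x => f x - g x).
Proof.
move=> bf bg; apply: bmD => //; have := bmM (bm_cst (-1)) bg.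
by under eq_fun do rewrite mulN1r.
Qed.

Lemma bm_sum I (l : seq I) (F : I -> T -> R) : (forall i, bm (F i)) ->
  bm (fun x => \sum_(i <- l) F i x).
Proof.
move=> bF; elim: l => [|i l IH].
  by under eq_fun do rewrite big_nil; exact: bm_cst.
by under eq_fun do rewrite big_cons; exact: bmD.
Qed.

Lemma bm_integrable f : bm f -> P.-integrable D (EFin \o f).
Proof.
move=> [mf [M fM]]; apply: measurable_bounded_integrable => //.
- by rewrite [X in (X < _)%E]PD ltry.
- exact: measurable_funS mf.
- exists M; split; first exact: num_real.
  by move=> x Mx y _ /=; rewrite (le_trans (fM y))// ltW.
Qed.

Local Notation mean f := (Rintegral P D f).

Lemma mean_EFin f : bm f -> (\int[P]_(x in D) (f x)%:E)%E = (mean f)%:E.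
Proof. by move=> bf; rewrite fineK// integrable_fin_num//; exact: bm_integrable. Qed.

Lemma meanD f g : bm f -> bm g -> mean (fun x => f x + g x) = mean f + mean g.
Proof. by move=> bf bg; rewrite RintegralD//; exact: bm_integrable. Qed.

Lemma meanB f g : bm f -> bm g -> mean (fun x => f x - g x) = mean f - mean g.
Proof. by move=> bf bg; rewrite RintegralB//; exact: bm_integrable. Qed.

Lemma meanZ c f : bm f -> mean (fun x => c * f x) = c * mean f.
Proof. by move=> bf; rewrite RintegralZl//; exact: bm_integrable. Qed.

Lemma mean_cst c : mean (fun=> c) = c.
Proof. by rewrite Rintegral_cst// [X in fine X]PD mulr1. Qed.

(** The comparison is asked on [D] alone, because bounds that rest on stationarity are available
    only there. *)
Lemma le_mean f g : bm f -> bm g -> (forall x, D x -> f x <= g x) ->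
  mean f <= mean g.
Proof. by move=> bf bg fg; apply: le_Rintegral => //; exact: bm_integrable. Qed.

Lemma mean_sum I (l : seq I) (F : I -> T -> R) : (forall i, bm (F i)) ->
  mean (fun x => \sum_(i <- l) F i x) = \sum_(i <- l) mean (F i).
Proof.
move=> bF; elim: l => [|i l IH].
  by under eq_Rintegral do rewrite big_nil; rewrite big_nil mean_cst.
rewrite big_cons -IH -meanD//; last exact: bm_sum.
by under eq_Rintegral do rewrite big_cons.
Qed.

End mean.

(** Once [x] is within [e] of its supremum, it can gain no more than [e]. Applied to energies, this
    gives increments small uniformly in [m]. *)
Lemma nondecreasing_bounded_increment (R : realType) (x : nat -> R) (M e : R) :
  (forall k m, x k <= x (m + k)%N) -> (forall k, x k <= M) -> 0 < e ->
  exists K, forall k m, (K <= k)%N -> x (m + k)%N - x k <= e.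
Proof.
move=> xi xM e0.
have hs : has_sup (range x).
  by split; [exists (x 0%N), 0%N|exists M => _ [k _ <-]].
have [_ [K _ <-] xK] := sup_adherent e0 hs.
exists K => k m Kk.
have : x (m + k)%N <= sup (range x) by apply: ub_le_sup; [case: hs|exists (m + k)%N].
by have := xi K (k - K)%N; rewrite subnK//; move: xK; lra.
Qed.

Section bm_law.
Variables (R : realType) (A : finType) (a0 : A).
Local Notation Om := (Omega a0).
Local Notation PrOm := (pprobability Om R).

(** Preimages of rays are the generators [mset S r] for [r] in the unit interval, and are empty or
    everything for other [r]. *)
Lemma measurable_evaluation (S : set Om) : measurable S ->
  measurable_fun [set: PrOm] (fun nu : PrOm => fine (nu S)).
Proof.
move=> mS; apply: (measurability _ (RGenInftyO.measurableE R)) => _ [_ [r ->] <-].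
rewrite setTI.
have -> : (fun nu : PrOm => fine (nu S)) @^-1` [set` `]-oo, r[] = mset S r.
  apply/seteqP; split=> nu; rewrite /mset /= in_itv/= -lte_fin fineK//;
    exact: fin_num_measure.
have [r0|r0] := ltP r 0; first by rewrite lt0_mset.
have [r1|r1] := ltP 1 r; first by rewrite gt1_mset.
apply: sub_sigma_algebra; exists r; first by rewrite /= in_itv/= r0 r1.
by exists S.
Qed.

Lemma bm_law s : bounded_measurable (fun nu : PrOm => law nu s).
Proof.
split; first by apply: measurable_evaluation; exact: measurable_cyl.
exists 1 => nu; rewrite ger0_norm ?law_ge0// -lee_fin -lawE.
by apply: probability_le1; exact: measurable_cyl.
Qed.

Definition law_next (nu : probability Om R) a s := law nu (rcons s a).

Lemma bm_density a s :
  bounded_measurable (fun nu : PrOm => density (law nu) (law_next nu a) s).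
Proof.
split.
  rewrite /density; apply: measurable_funM; first exact: (bm_law _).1.
  (* On nonnegative reals the inverse, with value 0 at 0, is the power [-1], which is known to be
     measurable. *)
  rewrite (_ : (fun nu => _) = (fun nu : PrOm => law nu s `^ (-1))); last first.
    by apply/funext => nu; rewrite powR_inv1// law_ge0.
  by apply: (measurableT_comp (measurable_powR _)); exact: (bm_law _).1.
exists 1 => nu; rewrite ger0_norm.
  by apply: density_le1 => t; [exact: law_ge0|exact: law_rcons_le].
by apply: density_ge0 => t; [exact: law_ge0|exact: law_rcons_le].
Qed.

End bm_law.

(** * Learning the decomposition *)

(* The likelihood process [b / p] is a bounded martingale along
   right-extensions, so its increments tend to 0 in L1. *)
Lemma likelihood_increment (R : realType) (A : finType) (p b : seq A -> R)
    (a : A) (e : R) :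
  (forall s, 0 <= b s) -> (forall s, b s <= p s) ->
  (forall s, \sum_a p (rcons s a) = p s) ->
  (forall s, \sum_a b (rcons s a) = b s) -> 0 < e ->
  exists K, forall j, (K <= j)%N ->
  \sum_(t <- words A j)
    `|b (rcons t a) - b t * density p (fun s => p (rcons s a)) t| <= e.
Proof.
move=> b0 bp pr br e0.
(* Reversed words turn right-extensions into left-extensions, so the results on [density] and
   [energy] apply. *)
pose P s := p (rev s); pose B s := b (rev s).
have B0 s : 0 <= B s by exact: b0.
have BP s : B s <= P s by exact: bp.
have Pc s : \sum_a P (a :: s) = P s.
  by rewrite /P -[RHS]pr; apply: eq_bigr => x _; rewrite rev_cons.
have Bc s : \sum_a B (a :: s) = B s.
  by rewrite /B -[RHS]br; apply: eq_bigr => x _; rewrite rev_cons.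
pose c := P [::] + 1.
have P0 s : 0 <= P s by exact: le_trans (BP s).
have c0 : 0 < c by rewrite ltr_wpDl.
(* With this choice [e' * P [::]] is at most [e / 2], and so is an energy increment of at most
   [e' * (e / 2)] divided by [e']. *)
pose e' := e / (2 * c).
have e'0 : 0 < e' by rewrite divr_gt0// mulr_gt0.
have /(_ _ (mulr_gt0 e'0 (divr_gt0 e0 (ltr0n R 2)))) [K HK] :=
  nondecreasing_bounded_increment
    (fun k m => energy_nondecreasing B0 BP Pc Bc m k)
    (energy_le B0 BP Pc).
exists K => j Kj; rewrite -big_words_rev.
apply: le_trans (le_trans (density_increment_L1 B0 BP Pc Bc j 1 e'0) _); last first.
  have -> : e = e / 2 + e / 2 by lra.
  rewrite lerD//.
    have -> : e / 2 = e' * c by rewrite /e'; field; lra.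
    by rewrite ler_wpM2l// ?ltW// /c; lra.
  by rewrite ler_pdivrMr// mulrC HK.
apply: ler_sum => u _; rewrite big_words_cons.
under [leRHS]eq_bigr do rewrite big_words0.
(* Of the one-letter extensions only that by [a] is kept; the weight [P (a :: u)] clears the first
   quotient. *)
rewrite (bigD1 a)//= -[leLHS]addr0 lerD//; last first.
  by apply: sumr_ge0 => x _; rewrite mulr_ge0.
rewrite -[P (a :: u)]ger0_norm// -normrM mulrBr.
rewrite [P (a :: u) * _](mul_density B0 BP) {1}/B rev_cons.
rewrite /density /P /B rev_cons.
by rewrite le_eqVlt; apply/orP; left; apply/eqP; congr (`|_ - _|); ring.
Qed.

Section learning.
Variables (R : realType) (A : finType) (a0 : A).
Local Notation Om := (Omega a0).
Local Notation PrOm := (pprobability Om R).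
Variables (mu : probability Om R) (lam : probability PrOm R) (D : set PrOm).
Hypotheses (mD : measurable D) (lamD : lam D = 1%E).
Hypothesis st_mu : stationary mu.
Hypothesis st_D : forall nu : PrOm, D nu -> stationary (nu : probability Om R).
Local Notation mean f := (Rintegral lam D f).
Hypothesis mean_law : forall s, mean (fun nu : PrOm => law nu s) = law mu s.
Variable a : A.

(* Convertible to [cond nu s a]. *)
Definition cpred (nu : probability Om R) s := density (law nu) (law_next nu a) s.
Local Notation g := cpred.

Definition law_energy (nu : probability Om R) k :=
  energy (law nu) (law_next nu a) k.

Definition mean_energy k := mean (fun nu : PrOm => law_energy nu k).

Definition gap k (nu : probability Om R) :=
  \sum_(s <- words A k) law nu s * (g nu s - g mu s) ^+ 2.

Section one_law.
Variable nu : probability Om R.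

Lemma law_next_ge0 s : 0 <= law_next nu a s. Proof. exact: law_ge0. Qed.

Lemma law_next_le s : law_next nu a s <= law nu s.
Proof. exact: law_rcons_le. Qed.

Lemma law_next_cons s : stationary nu ->
  \sum_x law_next nu a (x :: s) = law_next nu a s.
Proof. by move=> st; rewrite /law_next -[RHS](law_cons _ st). Qed.

Lemma mul_cpred s : law nu s * g nu s = law nu (rcons s a).
Proof. exact: (mul_density law_next_ge0 law_next_le). Qed.

Lemma cpred_ge0 s : 0 <= g nu s.
Proof. exact: (density_ge0 law_next_ge0 law_next_le). Qed.

Lemma cpred_le1 s : g nu s <= 1.
Proof. exact: (density_le1 law_next_ge0 law_next_le). Qed.

End one_law.

Let bm_g s : bounded_measurable (fun nu : PrOm => g nu s).
Proof. exact: bm_density. Qed.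

Lemma bm_law_energy k : bounded_measurable (fun nu : PrOm => law_energy nu k).
Proof. by apply: bm_sum => s; apply: bmM; [exact: bm_law|exact: bm_g]. Qed.

Lemma bm_gap k : bounded_measurable (fun nu : PrOm => gap k nu).
Proof.
apply: bm_sum => s; apply: bmM; first exact: bm_law.
have bB : bounded_measurable (fun nu : PrOm => g nu s - g mu s).
  by apply: bmB; [exact: bm_g|exact: bm_cst].
exact: (bmM bB bB).
Qed.

Lemma mean_energy_nondecreasing k m : mean_energy k <= mean_energy (m + k).
Proof.
apply: le_mean => //; [exact: bm_law_energy|exact: bm_law_energy|].
move=> nu /st_D st; apply: energy_nondecreasing => s.
- exact: law_next_ge0.
- exact: law_next_le.
- exact: law_cons.
- exact: law_next_cons.
Qed.

Lemma mean_energy_le1 k : mean_energy k <= 1.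
Proof.
rewrite -[leRHS](mean_cst mD lamD); apply: le_mean => //.
- exact: bm_law_energy.
- exact: bm_cst.
- move=> nu /st_D st; rewrite -(law_nil nu); apply: energy_le => s.
  + exact: law_next_ge0.
  + exact: law_next_le.
  + exact: law_cons.
Qed.

(* Write [nu(s) (g_nu - g_mu)^2 = (g_nu - g_mu) (nu(sa) - g_mu nu(s))].
   Replacing [g_nu] by its value on the last [k] letters costs an energy
   increment; after averaging over [nu], the second sum is an increment of
   posterior means and the third one vanishes. *)
Lemma gap_le k m e (nu : PrOm) : D nu -> 0 < e ->
  gap (m + k) nu <= e + e^-1 * (law_energy nu (m + k) - law_energy nu k)
  + (\sum_(u <- words A k) \sum_(s <- words A m)
      (g nu u * law nu (rcons (s ++ u) a)
      - g mu (s ++ u) * (g nu u * law nu (s ++ u)))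
  + \sum_(s <- words A (m + k))
      (g mu s ^+ 2 * law nu s - g mu s * law nu (rcons s a))).
Proof.
move=> Dnu e0; have st := st_D Dnu.
have ln0 := law_next_ge0 nu; have lnle := law_next_le nu.
have lc s : \sum_x law nu (x :: s) = law nu s by exact: law_cons.
have lnc s : \sum_x law_next nu a (x :: s) = law_next nu a s.
  exact: law_next_cons.
have H := density_increment_L1 ln0 lnle lc lnc k m e0.
rewrite law_nil mulr1 [_ / e]mulrC in H.
apply: le_trans (lerD H (lexx _)).
rewrite addrA -big_split/= /gap.
rewrite !big_words_cat [X in X <= _]exchange_big [X in _ <= _ + X]exchange_big/=.
rewrite -big_split; apply: ler_sum => u _ /=.
rewrite -big_split -big_split; apply: ler_sum => s _ /=.
rewrite -!(mul_cpred nu) -/(g nu (s ++ u)) -/(g nu u).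
set x := g nu (s ++ u); set y := g nu u; set z := g mu (s ++ u).
set l := law nu _.
have -> : l * `|x - y| + (y * (l * x) - z * (y * l)) + (z ^+ 2 * l - z * (l * x)) =
  l * (x - z) ^+ 2 + l * (`|x - y| - (x - y) * (x - z)) by ring.
rewrite lerDl mulr_ge0 ?law_ge0// subr_ge0.
rewrite (le_trans (ler_norm _))// normrM -[leRHS]mulr1 ler_wpM2l//.
have := cpred_ge0 nu (s ++ u); have := cpred_le1 nu (s ++ u).
have := cpred_ge0 mu (s ++ u); have := cpred_le1 mu (s ++ u).
by rewrite -/x -/z ler_norml; lra.
Qed.

(** [gap_le] is averaged over [nu]. First [k] is fixed so that mean energy increments are small for
    all [m]; then the length is taken large enough for the finitely many likelihood processes, one
    for each word [u] of length [k]. *)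
Lemma mean_gap_cvg0 e : 0 < e ->
  exists K, forall j, (K <= j)%N -> mean (gap j) <= e.
Proof.
move=> e0; have e40 : 0 < e / 4 by lra.
have bl s : bounded_measurable (fun nu : PrOm => law nu s).
  exact: (bm_law R a0 s).
have [k Hk] := nondecreasing_bounded_increment mean_energy_nondecreasing
  mean_energy_le1 (exprn_gt0 2 e40).
(* Divided by [law mu t], this is the posterior mean of [g nu u] after observing [t]. *)
pose b u t := mean (fun nu : PrOm => g nu u * law nu t).
have bm_b u t : bounded_measurable (fun nu : PrOm => g nu u * law nu t).
  by apply: bmM; [exact: bm_g|exact: bm_law].
have b0 u t : 0 <= b u t.
  by apply: Rintegral_ge0 => nu _; rewrite mulr_ge0 ?cpred_ge0 ?law_ge0.
have ble u t : b u t <= law mu t.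
  rewrite -mean_law; apply: (le_mean mD lamD (bm_b u t) (bl t)).
  by move=> nu _; rewrite -[leRHS]mul1r ler_wpM2r ?law_ge0 ?cpred_le1.
have br u t : \sum_x b u (rcons t x) = b u t.
  rewrite -(mean_sum mD lamD); last by move=> x; exact: bm_b.
  by apply: eq_Rintegral => nu _; rewrite -mulr_sumr law_rcons.
(* The error is shared among the words [u] of length [k]; the successor keeps the divisor
   positive. *)
pose e' := e / 4 / (size (words A k)).+1%:R.
have e'0 : 0 < e' by rewrite divr_gt0.
have /choice[K HK] u :=
  likelihood_increment a (b0 u) (ble u) (law_rcons mu) (br u) e'0.
exists (\max_(u <- words A k) K u + k)%N => j Kj.
have [m jmk] : exists m, j = (m + k)%N.
  by exists (j - k)%N; rewrite subnK// (leq_trans _ Kj)// leq_addl.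
rewrite {j}jmk in Kj *.
have := le_mean mD lamD (bm_gap (m + k)) _ (fun nu Dnu => gap_le k m Dnu e40).
have bA : bounded_measurable (fun nu : PrOm =>
    e / 4 + (e / 4)^-1 * (law_energy nu (m + k) - law_energy nu k)).
  apply: bmD; first exact: bm_cst.
  by apply: bmM; [exact: bm_cst|apply: bmB; exact: bm_law_energy].
have bE : bounded_measurable (fun nu : PrOm =>
    law_energy nu (m + k) - law_energy nu k).
  by apply: bmB; exact: bm_law_energy.
have bF u s : bounded_measurable (fun nu : PrOm =>
    g nu u * law nu (rcons (s ++ u) a)
      - g mu (s ++ u) * (g nu u * law nu (s ++ u))).
  by apply: bmB; [exact: bm_b|apply: bmM; [exact: bm_cst|exact: bm_b]].
have bS u : bounded_measurable (fun nu : PrOm => \sum_(s <- words A m)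
    (g nu u * law nu (rcons (s ++ u) a)
      - g mu (s ++ u) * (g nu u * law nu (s ++ u)))).
  by apply: bm_sum => s; exact: bF.
have bG s : bounded_measurable (fun nu : PrOm =>
    g mu s ^+ 2 * law nu s - g mu s * law nu (rcons s a)).
  by apply: bmB; apply: bmM;
    [exact: bm_cst|exact: bm_law|exact: bm_cst|exact: bm_law].
have bT : bounded_measurable (fun nu : PrOm =>
    \sum_(u <- words A k) \sum_(s <- words A m)
    (g nu u * law nu (rcons (s ++ u) a)
      - g mu (s ++ u) * (g nu u * law nu (s ++ u)))).
  by apply: bm_sum.
have bU : bounded_measurable (fun nu : PrOm => \sum_(s <- words A (m + k))
    (g mu s ^+ 2 * law nu s - g mu s * law nu (rcons s a))).
  by apply: bm_sum.
move=> /(_ (bmD bA (bmD bT bU))) /le_trans; apply.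
rewrite (meanD mD lamD bA (bmD bT bU)) (meanD mD lamD bT bU).
rewrite (meanD mD lamD (bm_cst _ _) (bmM (bm_cst _ _) bE)) (mean_cst mD lamD).
rewrite (meanZ mD lamD _ bE).
rewrite (meanB mD lamD (bm_law_energy _) (bm_law_energy _)).
rewrite (mean_sum mD lamD _ bS) (mean_sum mD lamD _ bG).
(* Averaging replaces [law nu] by [law mu], and [law mu s * g mu s] is [law mu (rcons s a)]. *)
have -> : \sum_(s <- words A (m + k)) mean (fun nu : PrOm =>
    g mu s ^+ 2 * law nu s - g mu s * law nu (rcons s a)) = 0.
  apply: big1 => s _.
  rewrite (meanB mD lamD (bmM (bm_cst _ _) (bl _)) (bmM (bm_cst _ _) (bl _))).
  rewrite !(meanZ mD lamD _ (bl _)) !mean_law -mul_cpred.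
  by ring.
have E1 : (e / 4)^-1 * (mean_energy (m + k) - mean_energy k) <= e / 4.
  by rewrite mulrC ler_pdivrMr// -expr2 Hk.
have E2 : \sum_(u <- words A k) mean (fun nu : PrOm => \sum_(s <- words A m)
    (g nu u * law nu (rcons (s ++ u) a)
      - g mu (s ++ u) * (g nu u * law nu (s ++ u))))
    <= e / 4.
  apply: (@le_trans _ _ (\sum_(u <- words A k) e')).
    rewrite big_seq [leRHS]big_seq; apply: ler_sum => u uk.
    rewrite (mean_sum mD lamD _ (bF u)).
    have Kum : (K u <= m + k)%N.
      apply: leq_trans Kj; rewrite (leq_trans _ (leq_addr _ _))//.
      exact: leq_bigmax_seq.
    apply: le_trans (HK u (m + k)%N Kum).
    (* The increment of [b u] runs over all words of length [m + k]; only those ending in [u] are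
       kept. *)
    rewrite big_words_cat exchange_big/= (big_rem u uk)/= -[leLHS]addr0.
    rewrite lerD ?sumr_ge0// => [|v _]; last exact: sumr_ge0.
    apply: ler_sum => s _; apply: le_trans (ler_norm _).
    rewrite (meanB mD lamD (bm_b _ _) (bmM (bm_cst _ _) (bm_b _ _))).
    by rewrite (meanZ mD lamD _ (bm_b _ _)) [b u (s ++ u) * _]mulrC.
  rewrite big_const_seq count_predT iter_addr_0 -[leLHS]mulr_natr /e'.
  rewrite -mulrA ger_pMr// mulrC.
  by rewrite ler_pdivrMr ?mul1r ?ler_nat.
move: E1 E2; rewrite /mean_energy; lra.
Qed.


(** * Maximal inequalities for the prediction error *)

Variable e : R.
Hypothesis e_gt0 : 0 < e.

Definition dist (nu : probability Om R) s := `|g nu s - g mu s|.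

(** All suffixes of length at least [k] are tested, so that the event is inherited by
    left-extensions, as the maximal ergodic inequality requires. The factor 3 accounts for the three
    distances in [far_dev]. *)
Fixpoint far k (nu : probability Om R) s :=
  (k <= size s)%N && (3 * e < dist nu s) ||
  (if s is _ :: s' then far k nu s' else false).

Let dev (nu : probability Om R) := deviates (law nu) (law_next nu a) e.

Lemma far_small k nu s : (size s < k)%N -> far k nu s = false.
Proof.
elim: s => [|x s IH] /= sk; first by rewrite leqNgt sk.
by rewrite leqNgt sk/= IH// ltnW.
Qed.

Lemma far_dist k nu s : (k <= size s)%N -> ~~ far k nu s -> dist nu s <= 3 * e.
Proof. by case: s => [|x s] /= -> /=; rewrite negb_or -leNgt => /andP[]. Qed.

(** Triangle inequality from [g nu t] to [g mu t] through [g nu u] and [g mu u], for a suffix [t]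
    that contains [u]; shorter suffixes are not tested. *)
Lemma far_dev nu s u :
  far (size u) nu (s ++ u) -> [|| dev nu u s, dev mu u s | e < dist nu u].
Proof.
have tri t : e < `|g nu t - g nu u| \/ e < `|g mu t - g mu u| \/ e < dist nu u \/
    dist nu t <= 3 * e.
  have [|e1] := ltP e; first by left.
  have [|e2] := ltP e `|g mu t - g mu u|; first by right; left.
  have [|e3] := ltP e (dist nu u); first by right; right; left.
  right; right; right; move: e1 e2 e3; rewrite /dist !ler_norml; lra.
elim: s => [|x s IH].
  rewrite cat0s; have [//|Nfar] := boolP (e < dist nu u); first by rewrite !orbT.
  suff: ~~ far (size u) nu u by move=> /negPf ->.
  rewrite -leNgt in Nfar; have du : dist nu u <= 3 * e.
    by rewrite (le_trans Nfar)// ler_peMl ?(ltW e_gt0)// ler1n.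
  by case: u du {tri Nfar} => [|y u] du /=; rewrite ltNge du ?far_small// andbF.
rewrite cat_cons [far _ _ _]/= => /orP[/andP[_]|/IH].
  have := tri ((x :: s) ++ u); rewrite /dev /= -/(g nu _) -/(g mu _).
  move=> [->//|[->|[->|]]]; rewrite ?orbT//.
  by move=> /le_lt_trans/[apply]; rewrite ltxx.
by rewrite /dev/= => /or3P[] ->; rewrite !orbT.
Qed.

(** The values of [g mu] form a martingale under [mu], in general not under [nu], so Kolmogorov's
    inequality controls this mass only after averaging over [nu]. *)
Definition far_by_mu k m (nu : probability Om R) :=
  \sum_(u <- words A k) \sum_(s <- words A m) law nu (s ++ u) * (dev mu u s)%:R.

Definition far_bound k m (nu : probability Om R) :=
  (e ^+ 2)^-1 * (law_energy nu (m + k) - law_energy nu k + gap k nu)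
  + far_by_mu k m nu.

Lemma law_maximal k m nu : stationary nu ->
  \sum_(u <- words A k) \sum_(s <- words A m) law nu (s ++ u) * (dev nu u s)%:R
  <= (e ^+ 2)^-1 * (law_energy nu (m + k) - law_energy nu k).
Proof.
move=> st; rewrite mulrC ler_pdivlMr ?exprn_gt0// mulrC.
apply: maximal_density => // s.
- exact: law_next_ge0.
- exact: law_next_le.
- exact: law_cons.
- exact: law_next_cons.
Qed.

(** Union bound over the alternatives of [far_dev]: Kolmogorov's inequality for [nu], Chebyshev's
    inequality for [dist nu u], and [far_by_mu] as it stands. *)
Lemma far_le k m nu : stationary nu ->
  \sum_(s <- words A (m + k)) law nu s * (far k nu s)%:R <= far_bound k m nu.
Proof.
move=> st; rewrite /far_bound mulrDr -addrA.
apply: le_trans (lerD (law_maximal k m st) (lexx _)).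
rewrite big_words_cat exchange_big/= /gap mulr_sumr.
rewrite /far_by_mu -!big_split/= big_seq [leRHS]big_seq.
apply: ler_sum => u; rewrite mem_words => /eqP uk.
have dist_sqr : (e < dist nu u)%R%:R <= (e ^+ 2)^-1 * (g nu u - g mu u) ^+ 2.
  have [ed|_] := ltP; last by rewrite mulr_ge0 ?invr_ge0 ?sqr_ge0.
  rewrite mulrC ler_pdivlMr ?exprn_gt0// mul1r -[leRHS]real_normK ?num_real//.
  by rewrite lerXn2r ?nnegrE ?normr_ge0 ?(ltW e_gt0)// ltW.
rewrite mulrCA -[X in X * (_ * _)](sum_words_cat m u (fun s => law_cons s st)).
rewrite mulr_suml -!big_split/=; apply: ler_sum => s _.
rewrite -!mulrDr ler_wpM2l ?law_ge0//.
have := @far_dev nu s u; rewrite uk; case: far => [/(_ isT)|_]; last first.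
  by rewrite !addr_ge0// mulr_ge0 ?invr_ge0 ?sqr_ge0.
move: dist_sqr; case: (e < dist nu u)%R; case: (dev nu u s);
  case: (dev mu u s) => //=; lra.
Qed.

Lemma far_bound_nondecreasing k m nu : stationary nu ->
  far_bound k m nu <= far_bound k m.+1 nu.
Proof.
move=> st; rewrite /far_bound lerD//.
  rewrite ler_wpM2l ?invr_ge0 ?sqr_ge0// lerD2r lerD2r -add1n -addnA.
  apply: energy_nondecreasing => s.
  - exact: law_next_ge0.
  - exact: law_next_le.
  - exact: law_cons.
  - exact: law_next_cons.
rewrite /far_by_mu; apply: ler_sum => u _.
rewrite big_words_cons exchange_big/=; apply: ler_sum => s _.
rewrite -(law_cons (s ++ u) st) mulr_suml; apply: ler_sum => x _.
rewrite ler_wpM2l ?law_ge0// ler_nat.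
by rewrite /dev/=; case: (deviates _ _ _ u s); rewrite ?orbT.
Qed.

Lemma bm_far_by_mu k m : bounded_measurable (fun nu : PrOm => far_by_mu k m nu).
Proof.
apply: bm_sum => u; apply: bm_sum => s.
by apply: bmM; [exact: bm_law|exact: bm_cst].
Qed.

Lemma bm_energy_gap k m : bounded_measurable
  (fun nu : PrOm => law_energy nu (m + k) - law_energy nu k + gap k nu).
Proof.
apply: bmD; last exact: bm_gap.
by apply: bmB; exact: bm_law_energy.
Qed.

Lemma bm_far_bound k m : bounded_measurable (fun nu : PrOm => far_bound k m nu).
Proof.
apply: bmD; last exact: bm_far_by_mu.
by apply: bmM; [exact: bm_cst|exact: bm_energy_gap].
Qed.

(** The event [dev mu u s] does not involve [nu], so averaging turns [law nu] into [law mu], and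
    [law_maximal] applies to [mu]. *)
Lemma mean_far_by_mu k m : mean (fun nu : PrOm => far_by_mu k m nu) <=
  (e ^+ 2)^-1 * (law_energy mu (m + k) - law_energy mu k).
Proof.
have bl s : bounded_measurable (fun nu : PrOm => law nu s).
  exact: (bm_law R a0 s).
have bF u s : bounded_measurable (fun nu : PrOm => law nu (s ++ u) * (dev mu u s)%:R).
  by apply: bmM; [exact: bl|exact: bm_cst].
apply: le_trans (law_maximal k m st_mu).
rewrite (mean_sum mD lamD) => [|u]; last by apply: bm_sum => s; exact: bF.
apply: ler_sum => u _; rewrite (mean_sum mD lamD _ (bF u)); apply: ler_sum => s _.
under eq_Rintegral do rewrite mulrC.
by rewrite (meanZ mD lamD _ (bl _)) mean_law mulrC.
Qed.

Lemma mean_far_bound d : 0 < d ->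
  exists k, forall m, mean (fun nu : PrOm => far_bound k m nu) <= d.
Proof.
(* Both energy increments and the mean gap are made at most [c]; each then costs [d / 3] after
   division by [e ^+ 2]. *)
move=> d0; pose c := e ^+ 2 * (d / 3).
have e20 : 0 < e ^+ 2 by rewrite exprn_gt0.
have c0 : 0 < c by rewrite mulr_gt0// divr_gt0.
have ln0 := law_next_ge0 mu; have lnle := law_next_le mu.
have lc s : \sum_x law mu (x :: s) = law mu s by exact: law_cons.
have lnc s : \sum_x law_next mu a (x :: s) = law_next mu a s.
  exact: law_next_cons.
have [K1 H1] := nondecreasing_bounded_increment mean_energy_nondecreasing
  mean_energy_le1 c0.
have [K2 H2] := nondecreasing_bounded_increment
  (fun k m => energy_nondecreasing ln0 lnle lc lnc m k) (energy_le ln0 lnle lc) c0.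
have [K3 H3] := mean_gap_cvg0 c0.
pose k := maxn K1 (maxn K2 K3).
have K1k : (K1 <= k)%N by rewrite leq_max leqnn.
have K2k : (K2 <= k)%N by rewrite !leq_max leqnn !orbT.
have K3k : (K3 <= k)%N by rewrite !leq_max leqnn !orbT.
exists k => m.
have bEk n : bounded_measurable (fun nu : PrOm => law_energy nu n).
  exact: bm_law_energy.
rewrite (meanD mD lamD); [|by apply: bmM; [exact: bm_cst|exact: bm_energy_gap]
  |exact: bm_far_by_mu].
rewrite (meanZ mD lamD _ (bm_energy_gap k m)).
rewrite (meanD mD lamD (bmB (bEk _) (bEk _)) (bm_gap k)).
rewrite (meanB mD lamD (bEk _) (bEk _)).
have {}H1 := H1 k m K1k; have {}H2 := H2 k m K2k; have {}H3 := H3 k K3k.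
apply: le_trans (lerD (lexx _) (mean_far_by_mu k m)) _.
rewrite -mulrDr mulrC ler_pdivrMr//.
have -> : d * e ^+ 2 = c + c + c by rewrite /c; field.
by rewrite !lerD.
Qed.


(** * Frequency of large prediction errors along a path *)

Local Notation prefix := (@Defs.prefix A a0).

Definition frequently_far k (nu : probability Om R) : set Om :=
  [set w | exists N, e * N%:R < \sum_(n < N) (far k nu (prefix w n))%:R].

Lemma frequently_far_le k (nu : PrOm) (c : \bar R) : D nu ->
  (forall m, (far_bound k m nu)%:E <= c)%E ->
  (e%:E * (nu : probability Om R) (frequently_far k nu) <= c)%E.
Proof.
move=> /st_D st kc; apply: exceeds_measure => //.
  by move=> x s /= ->; rewrite orbT.
move=> n; rewrite measure_prefix.
have far_bound0 m : 0 <= far_bound k m nu.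
  apply: le_trans (far_le k m st); apply: sumr_ge0 => s _.
  by rewrite mulr_ge0 ?law_ge0.
have [nk|kn] := ltnP n k.
  rewrite big_seq big1 => [|s]; last first.
    by rewrite mem_words => /eqP sn; rewrite far_small ?sn// mulr0.
  by apply: le_trans (kc 0%N); rewrite lee_fin.
by apply: le_trans (kc (n - k)%N); rewrite lee_fin -{1}(subnK kn) far_le.
Qed.

(** The first [k] terms cost at most 1 each, the far times at most [e * N] in total, and any other
    time at most [3 * e]. *)
Lemma dist_sum_le k (nu : PrOm) (w : Om) : ~ frequently_far k nu w ->
  forall N, \sum_(n < N) dist nu (prefix w n) <= k%:R + 4 * e * N%:R.
Proof.
move=> Nfar N.
have far_N : \sum_(n < N) (far k nu (prefix w n))%:R <= e * N%:R.
  by rewrite leNgt; apply/negP => ?; apply: Nfar; exists N.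
have -> : k%:R + 4 * e * N%:R = k%:R + (N%:R * (3 * e) + e * N%:R) by ring.
apply: le_trans (lerD (lexx _) (lerD (lexx _) far_N)).
have dist1 s : dist nu s <= 1.
  have := cpred_ge0 nu s; have := cpred_le1 nu s.
  have := cpred_ge0 mu s; have := cpred_le1 mu s.
  by rewrite /dist ler_norml; lra.
apply: (@le_trans _ _ (\sum_(n < N) ((n < k)%N%:R +
    (3 * e + (far k nu (prefix w n))%:R)))).
  apply: ler_sum => n _; have [nk|kn] := ltnP n k.
    rewrite (le_trans (dist1 _))// lerDl addr_ge0// mulr_ge0// ltW//.
  rewrite add0r; case: (boolP (far _ _ _)) => [_|/far_dist].
    by rewrite (le_trans (dist1 _))// lerDr mulr_ge0// ltW.
  by rewrite size_mkseq addr0; exact.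
rewrite !big_split/= sumr_const card_ord -[_ *+ N]mulr_natl lerD2r.
rewrite -natr_sum ler_nat.
elim: N {far_N} => [|N IH]; first by rewrite big_ord0.
rewrite big_ord_recr/=; case: ltnP => [Nk|_]; last by rewrite addn0.
rewrite addn1 (leq_trans _ Nk)// ltnS -[leqRHS](card_ord N) -sum1_card.
by apply: leq_sum => n _; case: (_ < _)%N.
Qed.

Lemma measurable_frequently_far k nu : measurable (frequently_far k nu).
Proof.
have -> : frequently_far k nu = \bigcup_N [set w : Om | (fun s : seq A =>
    e * N%:R < \sum_(n < N) (far k nu (take n s))%:R) (prefix w N)].
  apply/seteqP; split=> [w [N eN]|w [N _ eN]]; exists N => //; move: eN => /=;
    congr (is_true (_ < _)); apply: eq_bigr => n _;
    by rewrite take_prefix// ltnW.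
apply: bigcupT_measurable => N.
exact: (measurable_prefix (fun s : seq A =>
  e * N%:R < \sum_(n < N) (far k nu (take n s))%:R) N).
Qed.

(** Choose [k i] so that [far_bound (k i) m] has mean at most [1 / (i + 1)] for all [m]. Its limit
    [F i] in [m] dominates [e] times the measure of [frequently_far (k i) nu]. The infimum of the
    [F i] vanishes for almost every [nu], and then almost no [w] lies in all these events. *)
Lemma ae_dist_sum_le : {ae lam, forall nu : PrOm,
  {ae (nu : probability Om R), forall w : Om, exists k : nat,
    forall N, \sum_(n < N) dist nu (prefix w n) <= k%:R + 4 * e * N%:R}}.
Proof.
have d0 i : 0 < (i.+1%:R^-1 : R) by rewrite invr_gt0.
have /choice[k Hk] i := mean_far_bound (d0 i).
pose F i (nu : PrOm) := limn (fun m => (far_bound (k i) m nu)%:E).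
have ndF i nu : D nu -> nondecreasing_seq (fun m => (far_bound (k i) m nu)%:E).
  move=> /st_D st; apply/nondecreasing_seqP => m.
  by rewrite lee_fin far_bound_nondecreasing.
have cvgF i nu : D nu ->
    (fun m => (far_bound (k i) m nu)%:E) @ \oo --> F i nu.
  by move=> Dnu; apply: ereal_nondecreasing_is_cvgn; exact: ndF.
have leF i nu m : D nu -> ((far_bound (k i) m nu)%:E <= F i nu)%E.
  move=> Dnu; apply: lime_ge; first exact: cvgF.
  by exists m => // n /= mn; exact: ndF.
have mb i m : measurable_fun D (fun nu : PrOm => (far_bound (k i) m nu)%:E).
  apply/measurable_EFinP; apply: measurable_funS (bm_far_bound _ _).1 => //.
have mF i : measurable_fun D (F i).
  by apply: (emeasurable_fun_cvg _ _ (mb i)) => nu; exact: cvgF.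
have far_bound0 i m (nu : PrOm) : D nu -> (0 <= (far_bound (k i) m nu)%:E)%E.
  move=> /st_D st; rewrite lee_fin.
  apply: le_trans (far_le (k i) m st); apply: sumr_ge0 => s _.
  by rewrite mulr_ge0 ?law_ge0.
have F0 i nu : D nu -> (0 <= F i nu)%E.
  by move=> Dnu; exact: le_trans (far_bound0 i 0%N nu Dnu) (leF i nu 0%N Dnu).
have intF i : (\int[lam]_(nu in D) F i nu <= i.+1%:R^-1%:E)%E.
  rewrite monotone_convergence//; last first.
  - by move=> nu Dnu; exact: ndF.
  - by move=> m nu Dnu; exact: far_bound0.
  apply: lime_le.
    apply: ereal_nondecreasing_is_cvgn => m n mn; apply: ge0_le_integral => //.
    - by move=> nu Dnu; exact: far_bound0.
    - by move=> nu Dnu; exact: ndF.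
  apply: nearW => m; rewrite (mean_EFin mD lamD (bm_far_bound _ _)) lee_fin.
  exact: Hk.
(* Nothing orders the functions [F i]; for their infimum, arbitrarily small integrals are enough. *)
pose v nu := einfs (F ^~ nu) 0%N.
have v_le nu i : (v nu <= F i nu)%E by apply: ereal_inf_lbound; exists i.
have v0 nu : D nu -> (0 <= v nu)%E.
  by move=> Dnu; apply/ereal_infP => _ [i _ <-]; exact: F0.
have mv : measurable_fun D v by apply: measurable_fun_einfs.
have : (\int[lam]_(nu in D) `|v nu| = 0)%E.
  apply/eqP; rewrite eq_le integral_ge0 ?andbT//.
  apply/lee_addgt0Pr => d d_gt0; rewrite add0e.
  pose i := Num.truncn d^-1.
  apply: (@le_trans _ _ i.+1%:R^-1%:E); last first.
    by rewrite lee_fin invf_ple ?posrE// ltW// Num.Theory.truncnS_gt.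
  apply: le_trans (intF i); apply: ge0_le_integral => //.
    exact: measurableT_comp.
  by move=> nu Dnu; rewrite gee0_abs ?v0.
move=> /(ae_eq_integral_abs lam mD mv) v_ae.
have D_ae : {ae lam, forall nu, D nu}.
  exists (~` D); split => //; first exact: measurableC.
  by rewrite probability_setC// lamD subee.
apply: filterS2 D_ae v_ae => nu Dnu /(_ Dnu)/= vnu.
exists (\bigcap_i frequently_far (k i) nu); split.
- by apply: bigcapT_measurable => i; exact: measurable_frequently_far.
- apply/eqP; rewrite -measure_le0 -(@lee_pmul2l _ e%:E)// mule0 -vnu.
  apply/ereal_infP => _ [i _ <-].
  apply: le_trans (frequently_far_le Dnu (fun m => leF i nu m Dnu)).
  rewrite lee_pmul2l// le_measure ?inE//.
  + by apply: bigcapT_measurable => j; exact: measurable_frequently_far.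
  + exact: measurable_frequently_far.
  + exact: bigcap_inf.
- move=> w /= Nw i _; apply: contrapT => /dist_sum_le H.
  by apply: Nw; exists (k i).
Qed.

End learning.

(** * From linear bounds on sums to weak merging *)

Lemma strong_cesaro0 (R : realType) (x : nat -> R) : (forall n, 0 <= x n) ->
  (forall e, 0 < e -> exists K, forall N, \sum_(n < N) x n <= K + e * N%:R) ->
  strong_cesaro x 0.
Proof.
move=> x0 xe; apply/cvgr0Pnorm_le => e e0.
have [K HK] := xe (e / 2) (divr_gt0 e0 (ltr0n _ 2)).
(* From here on [K] is at most [e / 2 * N]; the other half of [e] is the slope. *)
exists (Num.truncn (2 * `|K| / e)).+1 => // N /= KN.
have N0 : 0 < N%:R :> R by rewrite ltr0n (leq_trans _ KN).
under eq_bigr do rewrite subr0 ger0_norm//.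
rewrite ger0_norm ?mulr_ge0 ?invr_ge0 ?ler0n ?sumr_ge0//.
rewrite mulrC ler_pdivrMr//; apply: le_trans (HK N) _.
have : 2 * `|K| <= e * N%:R.
  rewrite -ler_pdivrMl// mulrC.
  by rewrite (le_trans (ltW (truncnS_gt _)))// ler_nat.
by have := ler_norm K; lra.
Qed.

Lemma mean_law_eq (R : realType) (A : finType) (a0 : A)
    (mu : probability (Omega a0) R)
    (lam : probability (pprobability (Omega a0) R) R)
    (N : set (pprobability (Omega a0) R)) :
  (forall S : set (Omega a0), measurable S -> mu S = (\int[lam]_nu nu S)%E) ->
  measurable N -> lam N = 0%E ->
  forall s, Rintegral lam (~` N) (fun nu => law nu s) = law mu s.
Proof.
move=> mulam mN N0 s; have mc := @measurable_cyl A a0 s.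
have bl := bm_law R a0 s.
suff : ((Rintegral lam (~` N) (fun nu => law nu s))%:E = (law mu s)%:E)%E by case.
rewrite -mean_EFin//; last 2 first.
- exact: measurableC.
- by rewrite probability_setC// N0 sube0.
rewrite -lawE mulam//; under [RHS]eq_integral do rewrite lawE.
rewrite -setTD; apply/esym/ge0_negligible_integral => //.
- by apply/measurable_EFinP; exact: bl.1.
- by move=> nu _; rewrite lee_fin law_ge0.
Qed.

Theorem theorem1 (R : realType) (A : finType) (a0 : A)
    (mu : probability (Omega a0) R)
    (lam : probability (pprobability (Omega a0) R) R) :
  stationary mu ->
  ergodic_decomposition mu lam ->
  {ae lam, forall nu : pprobability (Omega a0) R, weakly_merges mu nu}.
Proof.
move=> st_mu [[N [mN N0 ergN]] mulam].
pose D := ~` N; have mD : measurable D by exact: measurableC.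
have lamD : lam D = 1%E by rewrite probability_setC// N0 sube0.
have st_D (nu : pprobability (Omega a0) R) :
    D nu -> stationary (nu : probability (Omega a0) R).
  by move=> Dnu; have [] : ergodic nu by apply: contrapT => /ergN.
have mean_law := mean_law_eq mulam mN N0.
(* Tolerances [1 / (i + 1)] and finitely many letters leave only countably many null sets to
   discard. *)
have H i : {ae lam, forall nu : pprobability (Omega a0) R, forall a : A,
    {ae (nu : probability (Omega a0) R), forall w : Omega a0, exists k : nat,
    forall M, \sum_(n < M) dist mu a nu (Defs.prefix w n)
      <= k%:R + 4 * i.+1%:R^-1 * M%:R}}.
  apply: filter_forall => a; apply: (ae_dist_sum_le mD lamD) => //.
apply: filterS (ae_foralln H) => nu {}H.
have {}H : {ae (nu : probability (Omega a0) R), forall w : Omega a0,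
    forall i a, exists k : nat,
    forall M, \sum_(n < M) dist mu a nu (Defs.prefix w n)
      <= k%:R + 4 * i.+1%:R^-1 * M%:R}.
  by apply: ae_foralln => i; apply: filter_forall => a; exact: H.
apply: filterS H => w H; apply: strong_cesaro0 => [n|e e0].
  exact: bigmax_ge_id.
(* Bounding the maximum over letters by the sum costs a factor [#|A|]; this [i] makes
   [4 * #|A| / (i + 1)] at most [e]. *)
pose i := Num.truncn (4 * #|A|%:R / e).
have /choice[k Hk] := H i.
exists (\sum_a (k a)%:R) => M.
apply: (@le_trans _ _ (\sum_(n < M) \sum_a dist mu a nu (Defs.prefix w n))).
  apply: ler_sum => n _; apply: bigmax_le => [|a _].
    by apply: sumr_ge0 => a _; exact: normr_ge0.
  rewrite distrC (bigD1 a)//= lerDl; apply: sumr_ge0 => b _; exact: normr_ge0.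
rewrite exchange_big/=.
apply: le_trans (ler_sum _ (fun a _ => Hk a M)) _.
rewrite big_split/= lerD2l sumr_const -[_ *+ _]mulr_natl mulrA ler_wpM2r//.
have := truncnS_gt (4 * #|A|%:R / e); rewrite -/i ltr_pdivrMr// => /ltW ie.
by rewrite mulrA ler_pdivrMr// mulrC [e * _]mulrC.
Qed.
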